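(* For every integer $n\ge 2$, the counting modality $C_n(X)$ is not expressible in the temporal logic $\mathit{QTL}(P_2,\dots,P_{n-1})$ over the non-negative real line (for $n=2$ this logic is just $\mathit{QTL}$): there is no formula $\varphi$ of $\mathit{QTL}(P_2,\dots,P_{n-1})$ whose only predicate name is $X$ such that for every $X\subseteq[0,\infty)$ and every $t\ge0$, $\varphi$ holds at $t$ in $\langle[0,\infty),<,X\rangle$ iff $C_n(X)$ holds at $t$.
   Context: Temporal logic formulas are built by the grammar $\varphi::=\mathit{True}\mid P\mid\neg\varphi\mid\varphi\wedge\varphi\mid O(\varphi_1,\dots,\varphi_k)$, where $P$ ranges over monadic predicate names and $O$ over the modalities of the logic. They are interpreted at points $t$ of a linear order with monadic predicates: $P$ holds at $t$ iff $t\in P$, Booleans as usual, and a modality $O$ with truth table $\overline O(t_0,X_1,\dots,X_k)$ holds at $t$ iff $\overline O(t,A_{\varphi_1},\dots,A_{\varphi_k})$ is true, where $A_{\varphi_i}$ is the set of points where $\varphi_i$ holds. $\mathit{QTL}$ has the four modalities: $X\,\mathbf{U}\,Y$: $\exists t_1(t_0<t_1\wedge Y(t_1)\wedge\forall t(t_0<t<t_1\to X(t)))$; $X\,\mathbf{S}\,Y$: $\exists t_1(t_1<t_0\wedge Y(t_1)\wedge\forall t(t_1<t<t_0\to X(t)))$; $\Diamond_1X$: $\exists t(t_0<t<t_0+1\wedge X(t))$; $\overleftarrow{\Diamond}_1X$: $\exists t(t<t_0<t+1\wedge X(t))$. The Pnueli modality $P_m(X_1,\dots,X_m)$ holds at $t_0$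 iff there are points $t_0<t_1<t_2<\dots<t_m<t_0+1$ with $X_i(t_i)$ for $i=1,\dots,m$. $\mathit{QTL}(P_2,\dots,P_{n-1})$ is $\mathit{QTL}$ extended with the modalities $P_2,\dots,P_{n-1}$. The counting modality $C_n(X)$ holds at $t_0$ iff there are at least $n$ distinct points $t$ with $t_0<t<t_0+1$ and $X(t)$. *)

(* Defs.v *)
From HB Require Import structures.
From mathcomp Require Import all_boot all_order all_algebra.
From mathcomp Require Import boolp classical_sets interval_inference reals.

Set Implicit Arguments.
Unset Strict Implicit.
Unset Printing Implicit Defensive.

Import Order.TTheory GRing.Theory Num.Theory.

Local Open Scope classical_set_scope.
Local Open Scope ring_scope.

(** Temporal logics are given by a type [M] of modality names with arities;
    [V] is the type of monadic predicate names. *)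
Section TemporalLogic.
Variables (V M : Type) (arity : M -> nat).

Inductive formula : Type :=
| FTrue
| FPred of V
| FNot of formula
| FAnd of formula & formula
| FMod (o : M) of ('I_(arity o) -> formula).

Variables (T : Type) (table : forall o : M, T -> ('I_(arity o) -> set T) -> Prop).
Variable (P : V -> set T).

Fixpoint holds (phi : formula) (t : T) : Prop :=
  match phi with
  | FTrue => True
  | FPred p => P p t
  | FNot psi => ~ holds psi t
  | FAnd psi1 psi2 => holds psi1 t /\ holds psi2 t
  | FMod o args => @table o t (fun i => [set s | holds (args i) s])
  end.

End TemporalLogic.

(** Truth tables over the time line [{nonneg R}] of non-negative reals: all
    points quantified over are non-negative. *)
Section Tables.
Variable R : realType.
Implicit Types X Y : set {nonneg R}.

Definition until_table X Y (t0 : {nonneg R}) : Prop :=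
  exists t1 : {nonneg R}, [/\ t0%:num < t1%:num, Y t1 &
    forall t : {nonneg R}, t0%:num < t%:num < t1%:num -> X t].

Definition since_table X Y (t0 : {nonneg R}) : Prop :=
  exists t1 : {nonneg R}, [/\ t1%:num < t0%:num, Y t1 &
    forall t : {nonneg R}, t1%:num < t%:num < t0%:num -> X t].

Definition future1_table X (t0 : {nonneg R}) : Prop :=
  exists t : {nonneg R}, t0%:num < t%:num < t0%:num + 1 /\ X t.

Definition past1_table X (t0 : {nonneg R}) : Prop :=
  exists t : {nonneg R}, t%:num < t0%:num < t%:num + 1 /\ X t.

Definition pnueli_table (m : nat) (X : 'I_m -> set {nonneg R})
    (t0 : {nonneg R}) : Prop :=
  exists t : 'I_m -> {nonneg R},
    [/\ forall i j : 'I_m, (i < j)%N -> (t i)%:num < (t j)%:num,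
        forall i : 'I_m, t0%:num < (t i)%:num < t0%:num + 1 &
        forall i : 'I_m, X i (t i)].

Definition counting_table (n : nat) X (t0 : {nonneg R}) : Prop :=
  exists t : 'I_n -> {nonneg R},
    injective t /\
    forall i : 'I_n, t0%:num < (t i)%:num < t0%:num + 1 /\ X (t i).

End Tables.

(** The modalities of QTL(P_2, ..., P_(n-1)); for [n = 2] there is no Pnueli
    modality and this is QTL. *)
Inductive qtl_modality (n : nat) : Type :=
| Until
| Since
| Future1
| Past1
| Pnueli (m : nat) of (2 <= m < n)%N.

Definition qtl_arity (n : nat) (o : qtl_modality n) : nat :=
  match o with
  | Until => 2
  | Since => 2
  | Future1 => 1
  | Past1 => 1
  | Pnueli m _ => m
  end.

Definition qtl_table (R : realType) (n : nat) (o : qtl_modality n) :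
    {nonneg R} -> ('I_(qtl_arity o) -> set {nonneg R}) -> Prop :=
  match o with
  | Until => fun t0 (A : 'I_2 -> _) => until_table (A ord0) (A ord_max) t0
  | Since => fun t0 (A : 'I_2 -> _) => since_table (A ord0) (A ord_max) t0
  | Future1 => fun t0 (A : 'I_1 -> _) => future1_table (A ord0) t0
  | Past1 => fun t0 (A : 'I_1 -> _) => past1_table (A ord0) t0
  | Pnueli m _ => fun t0 (A : 'I_m -> _) => pnueli_table A t0
  end.

Definition qtl_formula (n : nat) (V : Type) : Type :=
  formula V (@qtl_arity n).

Definition qtl_holds (R : realType) (n : nat) (V : Type)
    (P : V -> set {nonneg R}) (phi : qtl_formula n V) (t : {nonneg R}) : Prop :=
  holds (@qtl_table R n) P phi t.

(* Main.v *)
(** Take for [X] the multiples of a step [d] with [(n - 1) d < 1 < n d]. Every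
    window [(t, t + 1)] contains at least [n - 1] points of [X], and as many
    gaps between them, so a Pnueli modality with fewer than [n] arguments cannot
    locate [t] inside a gap. By induction, beyond some threshold the truth value
    of a formula at [t] depends only on whether [t] is in [X]; the threshold
    absorbs what the past modalities see near [0]. But [C_n] holds shortly
    before each point of [X] and fails shortly after it. *)
Require Import Defs.
From mathcomp Require Import all_boot all_order all_algebra.
From mathcomp Require Import boolp classical_sets interval_inference reals.
From mathcomp Require Import lra.

Set Implicit Arguments.
Unset Strict Implicit.
Unset Printing Implicit Defensive.

Import Order.TTheory GRing.Theory Num.Theory.

Local Open Scope classical_set_scope.
Local Open Scope ring_scope.

(** * Neighbouring points on and off the grid *)

Section Grid.
Variables (R : realType) (d : R).
Hypothesis d_gt0 : 0 < d.
Implicit Types (s t u v : {nonneg R}) (S A B : set {nonneg R}).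

Lemma nonneg_of (x : R) : 0 <= x -> exists t, t%:num = x.
Proof. by move=> x0; exists (NngNum x0). Qed.

Definition grid : set {nonneg R} := [set t | exists k : nat, t%:num = k%:R * d].

Lemma not_grid_between (k : nat) t :
  k%:R * d < t%:num < k.+1%:R * d -> ~ grid t.
Proof.
move=> /andP[lo hi] [j tj]; move: lo hi.
rewrite tj !ltr_pM2r // !ltr_nat => kj; by rewrite ltnS leqNgt kj.
Qed.

Lemma cell_right t : exists k : nat, k%:R * d <= t%:num < k.+1%:R * d.
Proof.
exists (Num.truncn (t%:num / d)).
rewrite -ler_pdivlMr // -ltr_pdivrMr //; apply: Num.Theory.truncn_itv.
by rewrite divr_ge0 // ltW.
Qed.

Lemma cell_left t : 0 < t%:num ->
  exists k : nat, k%:R * d < t%:num <= k.+1%:R * d.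
Proof.
move=> t0; have [k /andP[lo hi]] := cell_right t.
have [e|ne] := eqVneq (k%:R * d) t%:num; last first.
  by exists k; rewrite lt_neqAle ne lo ltW.
case: k e {lo hi} => [|k] e; first by move: t0; rewrite -e mul0r ltxx.
by exists k; rewrite -e lexx andbT ltr_pM2r // ltr_nat.
Qed.

(** The point [s] only prescribes whether [u] is on the grid, so that a witness [s] can later be
    copied next to another point. Take the right end of the cell of [t] if [s] is on the grid,
    otherwise the midpoint between [t] and that end. *)
Lemma grid_next t s : exists u,
  [/\ t%:num < u%:num <= t%:num + d, grid u <-> grid s &
      forall v, t%:num < v%:num < u%:num -> ~ grid v].
Proof.
have [k /andP[lo hi]] := cell_right t.
have kS : k.+1%:R * d = k%:R * d + d by rewrite -natr1 mulrDl mul1r.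
have t0 : 0 <= t%:num by [].
have [gs|ngs] := pselect (grid s).
  have [|u eu] := @nonneg_of (k.+1%:R * d); first lra.
  exists u; split; first by rewrite eu; lra.
    by split=> // _; exists k.+1.
  by move=> v ?; apply: (@not_grid_between k); lra.
have [|u eu] := @nonneg_of ((t%:num + k.+1%:R * d) / 2); first lra.
exists u; split; first by rewrite eu; lra.
  by split=> // gu; case: (@not_grid_between k u) => //; rewrite eu; lra.
by move=> v; rewrite eu => ?; apply: (@not_grid_between k); lra.
Qed.

Lemma grid_prev t s : d <= t%:num -> exists u,
  [/\ t%:num - d <= u%:num < t%:num, grid u <-> grid s &
      forall v, u%:num < v%:num < t%:num -> ~ grid v].
Proof.
move=> dt; have t0 : 0 < t%:num by exact: lt_le_trans dt.
have [k /andP[lo hi]] := cell_left t0.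
have kS : k.+1%:R * d = k%:R * d + d by rewrite -natr1 mulrDl mul1r.
have k0 : 0 <= k%:R * d by rewrite mulr_ge0 // ltW.
have [gs|ngs] := pselect (grid s).
  have [//|u eu] := @nonneg_of (k%:R * d).
  exists u; split; first by rewrite eu; lra.
    by split=> // _; exists k.
  by move=> v; rewrite eu => ?; apply: (@not_grid_between k); lra.
have [|u eu] := @nonneg_of ((t%:num + k%:R * d) / 2); first lra.
exists u; split; first by rewrite eu; lra.
  by split=> // gu; case: (@not_grid_between k u) => //; rewrite eu; lra.
by move=> v; rewrite eu => ?; apply: (@not_grid_between k); lra.
Qed.

Lemma not_grid_dense t u : t%:num < u%:num ->
  exists v, t%:num < v%:num < u%:num /\ ~ grid v.
Proof.
move=> tu; have [w [/andP[tw _] _ gap]] := grid_next t t.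
have t0 : 0 <= t%:num by [].
have [uw|wu] := leP u%:num w%:num.
  have [|v ev] := @nonneg_of ((t%:num + u%:num) / 2); first lra.
  by exists v; split; [|apply: gap]; rewrite ev; lra.
have [|v ev] := @nonneg_of ((t%:num + w%:num) / 2); first lra.
by exists v; split; [|apply: gap]; rewrite ev; lra.
Qed.

(** * Truth tables that far from 0 see only grid membership *)

(** One implication suffices, since [t] and [u] may be swapped. Natural thresholds can be merged by
    a maximum. *)
Definition grid_determined (K : nat) S := forall t u,
  K%:R < t%:num -> K%:R < u%:num -> (grid t <-> grid u) -> S t -> S u.

Lemma grid_determined_le (K L : nat) S :
  (K <= L)%N -> grid_determined K S -> grid_determined L S.
Proof.
rewrite -(ler_nat R) => KL SK t u Lt Lu.
by apply: SK; exact: le_lt_trans KL _.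
Qed.

(** Some non-grid point precedes the witness, so [A] holds off the grid everywhere beyond [K]. The
    next point after [u] of the witness's kind then works, as only non-grid points lie between. *)
Lemma grid_determined_until (K : nat) A B :
  grid_determined K A -> grid_determined K B ->
  grid_determined K (until_table A B).
Proof.
move=> hA hB t u Kt Ku _ [t1 [tt1 Bt1 At]].
have [a [/andP[ta at1] nga]] := not_grid_dense tt1.
have [u1 [/andP[uu1 _] gu1 gap]] := grid_next u t1.
exists u1; split=> //; first by apply: hB Bt1; [lra|lra|split=> /gu1].
move=> v /andP[uv vu1]; have ngv := gap v (introT andP (conj uv vu1)).
by apply: (hA a); [lra|lra|split|apply: At; lra].
Qed.

Hypothesis d_lt1 : d < 1.

(** A witness beyond [K] is replaced by a point of its kind just before [u]. A witness up to [K] is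
    kept, and [A] is then checked on and off the grid. *)
Lemma grid_determined_since (K : nat) A B :
  grid_determined K A -> grid_determined K B ->
  grid_determined K.+2 (since_table A B).
Proof.
move=> hA hB t u; rewrite -addn2 natrD => Kt Ku _ [t1 [tt1 Bt1 At]].
have [d1 K0] : d < 1 /\ 0 <= K%:R :> R by [].
have [k ek] := nonneg_of K0.
(* [m] is the maximum of [t1] and [K]: a non-grid point between [m] and [t] is beyond [K] and
   satisfies [A]. *)
have [m [t1m Km mt]] : exists m : {nonneg R},
    [/\ t1%:num <= m%:num, K%:R <= m%:num & m%:num < t%:num].
  by have [|] := leP t1%:num K%:R => ?; [exists k; rewrite ek | exists t1]; split; lra.
have [a [/andP[ma at_] nga]] := not_grid_dense mt.
have Agap v : K%:R < v%:num -> ~ grid v -> A v.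
  by move=> Kv ngv; apply: (hA a); [lra|lra|split|apply: At; lra].
have [t1K|Kt1] := leP t1%:num K%:R; last first.
  have [|u1 [/andP[lo hi] gu1 gap]] := @grid_prev u t1; first lra.
  exists u1; split=> //; first by apply: hB Bt1; [lra|lra|split=> /gu1].
  by move=> v /andP[uv vu]; apply: Agap; [lra|apply: gap; lra].
exists t1; split=> //; first lra.
move=> v /andP[t1v vu].
have [vK|Kv] := leP v%:num K%:R; first by apply: At; lra.
have [gv|ngv] := pselect (grid v); last exact: Agap.
(* The raised threshold leaves a grid point [b] between [K] and [t]; there [A] is known, and it
   transfers to [v]. *)
have [b [/andP[kb bk] gb _]] := grid_next k v.
by apply: (hA b) => //; [lra|apply: At; lra].
Qed.

Lemma grid_determined_future1 (K : nat) S :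
  grid_determined K S -> grid_determined K (future1_table S).
Proof.
move=> hS t u Kt Ku _ [s [/andP[ts _] Ss]].
have [v [/andP[uv vd] gv _]] := grid_next u s; have d1 := d_lt1.
by exists v; split; [lra|apply: hS Ss; [lra|lra|split=> /gv]].
Qed.

(** Raising the threshold by 1 keeps both the witness, less than 1 before [t], and its copy, at most
    [d] before [u], beyond [K]. *)
Lemma grid_determined_past1 (K : nat) S :
  grid_determined K S -> grid_determined K.+1 (past1_table S).
Proof.
move=> hS t u; rewrite -natr1 => Kt Ku _ [s [/andP[st ts] Ss]].
have [d1 K0] : d < 1 /\ 0 <= K%:R :> R by [].
have [|v [/andP[lo hi] gv _]] := @grid_prev u s; first lra.
by exists v; split; [lra|apply: hS Ss; [lra|lra|split=> /gv]].
Qed.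

(** Cut [m] successive slots of length [d] after [u]. Each contains points of both kinds, so the
    [i]-th witness is copied into the [i]-th slot; the slots keep the order and together fit in the
    unit window. *)
Lemma grid_determined_pnueli (K m : nat) (S : 'I_m -> set {nonneg R}) :
  m%:R * d < 1 -> (forall i, grid_determined K (S i)) ->
  grid_determined K (pnueli_table S).
Proof.
move=> md hS t u Kt Ku _ [s [_ st Ss]].
have u0 : 0 <= u%:num by [].
have /choice[v hv] (i : 'I_m) : exists v, (grid v <-> grid (s i)) /\
    u%:num + i%:R * d < v%:num <= u%:num + i.+1%:R * d.
  have [|w ew] := @nonneg_of (u%:num + i%:R * d).
    by rewrite addr_ge0 // mulr_ge0 // ltW.
  have [v [wv gv _]] := grid_next w (s i).
  by exists v; split=> //; rewrite -natr1 mulrDl mul1r addrA -ew.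
have itv i : u%:num < (v i)%:num < u%:num + 1.
  have [_ /andP[lo hi]] := hv i.
  have : 0 <= i%:R * d by rewrite mulr_ge0 // ltW.
  have : i.+1%:R * d <= m%:R * d by rewrite ler_pM2r // ler_nat.
  lra.
exists v; split=> // [i j ij|i].
  have [_ /andP[_ hi]] := hv i; have [_ /andP[lo _]] := hv j.
  have : i.+1%:R * d <= j%:R * d by rewrite ler_pM2r // ler_nat.
  lra.
have [gv _] := hv i; have := st i; have := itv i.
by move=> ? ?; apply: hS (Ss i); [lra|lra|split=> /gv].
Qed.

End Grid.

(** * Induction on formulas, then counting on the grid *)

Lemma qtl_grid_determined (R : realType) (d : R) (n : nat)
    (phi : qtl_formula n unit) :
  0 < d -> d < 1 -> n.-1%:R * d < 1 ->
  exists K, grid_determined d K (qtl_holds (fun _ => grid d) phi).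
Proof.
move=> d0 d1 nd; elim: phi => [|[]|p [K hK]|p [K hK] q [L hL]|o args IH].
- by exists 0%N.
- by exists 0%N => t u _ _ [].
- exists K => t u Kt Ku gtu np pu; apply: np.
  exact: hK Ku Kt (iff_sym gtu) pu.
- exists (maxn K L) => t u Kt Ku gtu [pt qt]; split.
    exact: (grid_determined_le (leq_maxl K L) hK) Kt Ku gtu pt.
  exact: (grid_determined_le (leq_maxr K L) hL) Kt Ku gtu qt.
have [L hL] : exists L, forall i,
    grid_determined d L (qtl_holds (fun _ => grid d) (args i)).
  have /choice[F hF] := IH; exists (\max_i F i)%N => i.
  exact: grid_determined_le (leq_bigmax i) (hF i).
case: o args hL {IH} => [||||m mn] args hL.
- exists L.
  exact (grid_determined_until d0 (hL (ord0 : 'I_2)) (hL (ord_max : 'I_2))).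
- exists L.+2.
  exact (grid_determined_since d0 d1 (hL (ord0 : 'I_2)) (hL (ord_max : 'I_2))).
- exists L; exact (grid_determined_future1 d0 d1 (hL (ord0 : 'I_1))).
- exists L.+1; exact (grid_determined_past1 d0 d1 (hL (ord0 : 'I_1))).
have md : m%:R * d < 1.
  have /andP[_ m_lt_n] := mn; apply: le_lt_trans nd.
  by rewrite ler_pM2r // ler_nat -ltnS (ltn_predK m_lt_n).
exists L; exact (grid_determined_pnueli d0 md hL).
Qed.

(** [(n - 1/2) d = 1] is the midpoint choice in [(n - 1) d < 1 < n d]. *)
Lemma counting_grid_before (R : realType) (d : R) (n k : nat) (t : {nonneg R}) :
  0 < d -> (n%:R - 1 / 2) * d = 1 -> t%:num = k%:R * d - d / 4 ->
  counting_table n (grid d) t.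
Proof.
move=> d0 nd et.
have p0 (i : 'I_n) : 0 <= (k + i)%:R * d by rewrite mulr_ge0 // ltW.
(* The last of these [n] points lies [(n - 3/4) d] after [t], which is less than
   [(n - 1/2) d = 1]. *)
exists (fun i => NngNum (p0 i)); split.
  move=> i j /(congr1 (fun x : {nonneg R} => x%:num)) /=.
  by move=> /(mulIf (lt0r_neq0 d0))/eqP; rewrite eqr_nat eqn_add2l => /eqP/val_inj.
move=> i; split; last by exists (k + i)%N.
rewrite /= et natrD mulrDl.
have : 0 <= i%:R * d by rewrite mulr_ge0 // ltW.
have : i.+1%:R * d <= n%:R * d by rewrite ler_pM2r // ler_nat.
rewrite -natr1 !mulrDl; move: nd; rewrite mulrBl; lra.
Qed.

(** The window runs from [(k - 3/4) d] to [(k + n - 5/4) d], so it meets only the [n - 1] multiples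
    from [k d] to [(k + n - 2) d]; the pigeonhole principle concludes. *)
Lemma counting_grid_after (R : realType) (d : R) (n k : nat) (t : {nonneg R}) :
  (0 < n)%N -> 0 < d -> (n%:R - 1 / 2) * d = 1 ->
  t%:num = k%:R * d - 3 * d / 4 -> ~ counting_table n (grid d) t.
Proof.
case: n => // n _ d0; rewrite -natr1 => nd et [s [injs hs]].
have /choice[f hf] (i : 'I_n.+1) : exists j : 'I_n, (s i)%:num = (k + j)%:R * d.
  have [/andP[lo hi] [j ej]] := hs i.
  have kj : (k <= j)%N.
    rewrite leqNgt -ltnS -(ler_nat R) -(ler_pM2r d0) -natr1 -natr1 !mulrDl.
    by apply/negP; move: lo; rewrite et ej; lra.
  have jn : (j - k < n)%N.
    rewrite ltnNge; apply/negP; rewrite -(ler_nat R) -(ler_pM2r d0) natrB //.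
    by move: hi nd; rewrite et ej mulrBl mulrDl mulrBl; lra.
  by exists (Ordinal jn); rewrite /= subnKC.
have /leq_card : injective f.
  move=> i j fij; apply: injs; apply/val_inj => /=.
  by rewrite (hf i) (hf j) fij.
by rewrite !card_ord ltnn.
Qed.

Theorem theorem3p3 (R : realType) (n : nat) (hn : (2 <= n)%N) :
  ~ exists phi : qtl_formula n unit,
      forall (X : set {nonneg R}%R) (t : {nonneg R}%R),
        qtl_holds (fun _ : unit => X) phi t <-> counting_table n X t.
Proof.
move=> [phi hphi].
have n2 : 2 <= n%:R :> R by rewrite (ler_nat R 2).
pose d : R := (n%:R - 1 / 2)^-1.
have d0 : 0 < d by rewrite invr_gt0; lra.
have nd : (n%:R - 1 / 2) * d = 1 by rewrite mulfV //; apply: lt0r_neq0; lra.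
have nd1 : n.-1%:R * d < 1.
  have : n.-1%:R + 1 = n%:R :> R by rewrite natr1 prednK // ltnW.
  by move=> e; rewrite -[ltRHS]nd ltr_pM2r //; lra.
have d1 : d < 1 by rewrite invf_lt1; lra.
have [K hK] := qtl_grid_determined phi d0 d1 nd1.
(* The offset 2 gives [K < (k - 1) d], so the whole cell between [(k - 1) d] and [k d] is beyond
   [K]. Both [t] and [u] are taken inside it: [phi] cannot separate them, but [C_n] does. *)
pose k := (Num.truncn (K%:R / d)).+2.
have kS : k%:R * d = k.-1%:R * d + d by rewrite /k /= -natr1 mulrDl mul1r.
have Kk : K%:R < k%:R * d - d.
  have : K%:R / d < k.-1%:R by exact: Num.Theory.truncnS_gt.
  by rewrite ltr_pdivrMr // kS; lra.
have K0 : 0 <= K%:R :> R by [].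
have [|t et] := @nonneg_of R (k%:R * d - d / 4); first lra.
have [|u eu] := @nonneg_of R (k%:R * d - 3 * d / 4); first lra.
have ngt : ~ grid d t by apply: (@not_grid_between _ _ d0 k.-1); lra.
have ngu : ~ grid d u by apply: (@not_grid_between _ _ d0 k.-1); lra.
apply: (counting_grid_after (ltnW hn) d0 nd eu); apply/hphi.
apply: (hK t); [lra|lra|by split|].
by apply/hphi; apply: counting_grid_before d0 nd et.
Qed.
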